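(* Let $G$ be a connected triangle-free graph, let $d\ge 2$ be an integer, and let $S\subseteq V(G)$. If $S$ is a general $d$-position set, then $S$ is a dissociation set. Moreover, if $d=2$, then $S$ is a general $2$-position set if and only if $S$ is a dissociation set.
   Context: Graphs are finite, simple, undirected. $d_G(u,w)$ denotes the shortest-path distance in $G$, and $I_G(u,w)=\{x\in V(G): d_G(u,w)=d_G(u,x)+d_G(x,w)\}$. A set $S\subseteq V(G)$ is a general $d$-position set if for any three distinct vertices $u,v,w\in S$ with $v\in I_G(u,w)$ we have $d_G(u,w)>d$. A set $S\subseteq V(G)$ is a dissociation set if the subgraph of $G$ induced by $S$ has maximum degree at most $1$. *)

(* Defs.v *)
From mathcomp Require Import all_boot.

Set Implicit Arguments.
Unset Strict Implicit.
Unset Printing Implicit Defensive.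

Definition simple_graph (V : finType) (e : rel V) : Prop :=
  symmetric e /\ irreflexive e.

Definition connected_graph (V : finType) (e : rel V) : Prop :=
  forall x y : V, connect e x y.

Definition triangle_free (V : finType) (e : rel V) : Prop :=
  forall x y z : V, ~~ [&& e x y, e y z & e x z].

Definition has_path (V : finType) (e : rel V) (k : nat) (u w : V) : bool :=
  [exists p : k.-tuple V, [&& path e u p, uniq (u :: p) & last u p == w]].

(* A path on V has at most #|V| - 1 edges, so the search over k < #|V| is
   exhaustive; if u and w are not connected, the junk value is #|V|. *)
Definition dist (V : finType) (e : rel V) (u w : V) : nat :=
  find (fun k => has_path e k u w) (iota 0 #|V|).

Definition interval (V : finType) (e : rel V) (u w : V) : {set V} :=
  [set x | dist e u w == dist e u x + dist e x w].

Definition general_position (V : finType) (e : rel V) (d : nat) (S : {set V})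
    : Prop :=
  forall u v w : V, u \in S -> v \in S -> w \in S ->
    u != v -> v != w -> u != w -> v \in interval e u w -> d < dist e u w.

Definition induced (V : finType) (e : rel V) (S : {set V})
    : rel {x : V | x \in S} :=
  fun x y => e (val x) (val y).

Definition max_degree (V : finType) (e : rel V) : nat :=
  \max_(x : V) #|[set y | e x y]|.

Definition dissociation (V : finType) (e : rel V) (S : {set V}) : Prop :=
  max_degree (@induced V e S) <= 1.

(* Main.v *)
Require Import Defs.
From mathcomp Require Import all_boot.

(** The link between the two conditions is the path with two edges.  A set fails
    to be a dissociation set exactly when some [v] in [S] has two distinct neighbours
    [u] and [w] in [S] ([dissociationP]).  If [G] has no triangle then [u] and
    [w] are not adjacent, so they are at distance exactly 2 and [v] is midway
    between them ([dist_cherry]): this triple violates general [d]-position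
    for every [d >= 2].

    For the converse with [d = 2], let [v] lie on a shortest path between [u]
    and [w] of length at most 2, all three distinct.  Both distances [d(u,v)]
    and [d(v,w)] are positive and their sum is at most 2, so both are 1, and
    [v] has the two neighbours [u] and [w] in [S].

    Only the distances 0, 1 and 2 matter, so it suffices to recognise them in
    terms of equality and adjacency ([dist_eq0], [dist_eq1], [dist_cherry]). *)

Section Distance.

Variables (V : finType) (e : rel V).
Implicit Types u v w : V.

(** Simplicity of the path bounds its length below [#|V|], so the bounded search
    defining [dist] does reach [k]. *)
Lemma dist_le k u w : has_path e k u w -> dist e u w <= k.
Proof.
move=> path_k; have k_lt : k < #|V|.
  have /existsP[p /and3P[_ uniq_p _]] := path_k.
  by have := max_card [in u :: p]; rewrite (card_uniqP uniq_p) /= size_tuple.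
rewrite leqNgt; apply/negP => /(before_find 0).
by rewrite nth_iota // add0n path_k.
Qed.

(** The hypothesis excludes the junk value of [dist]. *)
Lemma has_path_dist u w : dist e u w < #|V| -> has_path e (dist e u w) u w.
Proof.
move=> dist_lt; have := dist_lt.
rewrite -[X in _ < X](size_iota 0) -has_find => /(nth_find 0).
by rewrite -/(dist e u w) nth_iota.
Qed.

Lemma has_path0 u w : has_path e 0 u w = (u == w).
Proof.
apply/existsP/eqP => [[p]|->]; last by exists [tuple]; rewrite /= eqxx.
by rewrite (tuple0 p) => /= /eqP.
Qed.

Lemma has_path1 u w : has_path e 1 u w = e u w && (u != w).
Proof.
apply/existsP/idP => [[[[|x [|y p]] //= _]]|/andP[euw neq_uw]].
  by rewrite !andbT inE => /and3P[eux neq_ux /eqP<-]; rewrite eux.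
by exists [tuple w]; rewrite /= euw inE neq_uw eqxx.
Qed.

Lemma dist_eq0 u w : (dist e u w == 0) = (u == w).
Proof.
apply/eqP/idP => [d0|]; last by rewrite -has_path0 => /dist_le; case: dist.
rewrite -has_path0 -d0 has_path_dist // d0.
by apply/card_gt0P; exists u.
Qed.

(** In a one-vertex graph 1 is the junk value of [dist]; having two distinct
    vertices rules this out. *)
Lemma dist_eq1 u w : u != w -> (dist e u w == 1) = e u w.
Proof.
move=> neq_uw; have -> : e u w = has_path e 1 u w by rewrite has_path1 neq_uw andbT.
apply/eqP/idP => [d1|path1]; last first.
  by apply/eqP; rewrite eqn_leq dist_le // lt0n dist_eq0.
rewrite -d1 has_path_dist // d1.
by have := max_card [in [set u; w]]; rewrite cards2 neq_uw.
Qed.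

Lemma dist_cherry u v w :
  u != v -> v != w -> u != w -> e u v -> e v w -> ~~ e u w -> dist e u w = 2.
Proof.
move=> neq_uv neq_vw neq_uw euv evw neuw; apply/eqP; rewrite eqn_leq.
apply/andP; split.
  apply: dist_le; apply/existsP; exists [tuple v; w].
  by rewrite /= euv evw !inE negb_or neq_uv neq_uw neq_vw eqxx.
have := dist_eq0 u w; have := dist_eq1 u w neq_uw.
by rewrite (negPf neuw) (negPf neq_uw); case: dist => [|[]].
Qed.

End Distance.

Lemma dissociationP (V : finType) (e : rel V) (S : {set V}) :
  dissociation e S <->
  (forall v u w, v \in S -> u \in S -> w \in S -> e v u -> e v w -> u = w).
Proof.
split=> [dis v u w vS uS wS evu evw | unique_nbr].
  have deg_v : #|[set y | induced e (Sub v vS : {x | x \in S}) y]| <= 1.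
    apply: leq_trans dis.
    exact: (leq_bigmax (F := fun x => #|[set y | induced e x y]|)).
  have eq_uw : (Sub u uS : {x | x \in S}) = Sub w wS.
    by apply: (card_le1_eqP deg_v); rewrite inE.
  by have := congr1 val eq_uw; rewrite !SubK.
apply/bigmax_leqP => x _; apply/card_le1_eqP => y z; rewrite !inE => exy exz.
apply: val_inj; apply: (unique_nbr (val x)) => //; exact: valP.
Qed.

Lemma general_position_dissociation (V : finType) (e : rel V) (d : nat)
    (S : {set V}) :
  simple_graph e -> triangle_free e -> 2 <= d ->
  general_position e d S -> dissociation e S.
Proof.
move=> [sym_e irr_e] tf_e d_ge2 gp; apply/dissociationP => v u w vS uS wS evu evw.
apply/eqP/negPn/negP => neq_uw.
have neq_adj x y : e x y -> x != y by apply: contraTneq => ->; rewrite irr_e.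
have euv : e u v by rewrite sym_e.
have neuw : ~~ e u w by have := tf_e u v w; rewrite euv evw.
have neq_uv := neq_adj _ _ euv; have neq_vw := neq_adj _ _ evw.
have duw := dist_cherry _ _ _ _ _ neq_uv neq_vw neq_uw euv evw neuw.
have := gp u v w uS vS wS neq_uv neq_vw neq_uw.
have /eqP duv : dist e u v == 1 by rewrite dist_eq1.
have /eqP dvw : dist e v w == 1 by rewrite dist_eq1.
by rewrite inE duw duv dvw ltnNge d_ge2 => /(_ isT).
Qed.

Lemma dissociation_general_position2 (V : finType) (e : rel V) (S : {set V}) :
  symmetric e -> dissociation e S -> general_position e 2 S.
Proof.
move=> sym_e /dissociationP unique_nbr u v w uS vS wS neq_uv neq_vw neq_uw.
rewrite inE => /eqP duw; rewrite ltnNge; apply/negP => duw_le2.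
have duv_gt0 : 0 < dist e u v by rewrite lt0n dist_eq0.
have dvw_gt0 : 0 < dist e v w by rewrite lt0n dist_eq0.
have [duv dvw] : dist e u v = 1 /\ dist e v w = 1.
  move: duw_le2 duv_gt0 dvw_gt0; rewrite duw.
  by case: (dist e u v) => [|[|m]]; case: (dist e v w) => [|[|n]] //; rewrite addnS.
have euv : e u v by rewrite -dist_eq1 // duv.
have evw : e v w by rewrite -dist_eq1 // dvw.
by case/eqP: neq_uw; apply: (unique_nbr v); rewrite // sym_e.
Qed.

Theorem proposition5p3 (V : finType) (e : rel V)
    (hG : simple_graph e) (hconn : connected_graph e) (htf : triangle_free e)
    (d : nat) (hd : 2 <= d) (S : {set V}) :
  (general_position e d S -> dissociation e S) /\
  (d = 2 -> (general_position e 2 S <-> dissociation e S)).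
Proof.
split=> [|_]; first exact: general_position_dissociation.
split; first exact: general_position_dissociation.
by apply: dissociation_general_position2; case: hG.
Qed.
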